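(* Let $\Sigma$ be a planar model. For any $\varepsilon,C,\rho>0$ there exists $N_\varepsilon=N(\varepsilon,C,\rho)$ such that: if $\omega\in\Omega$ and $k\in\mathbb N$ are such that $\eta^{(T^{k'(\omega)}\omega)}$ is $(C,\rho)$-Frostman on tubes, and $n=k'(\omega)+N_\varepsilon$, then $$\mathbf P_{i=k}\big(d_{TV}(\eta^{(\omega)}_{x,i},\ \eta^{(\omega)}_{n,[x,i]})<\varepsilon\big)>1-\varepsilon,$$ where $d_{TV}$ is the total variation distance.
   Context: Planar model $\Sigma$: $I$ finite; $f^{(i)}_j(z)=\lambda_iz+t^{(i)}_j$, $\lambda_i=r_i\varphi_i$, $0<r_i<1$; positive probability vectors $p_i$; $\Omega=I^{\mathbb N}$, $T$ the shift. For $u\in\mathbb X^{(\omega)}_n=\prod_{j\le n}\{1,\dots,k_{\omega_j}\}$, $f^{(\omega)}_u=f^{(\omega_1)}_{u_1}\circ\dots\circ f^{(\omega_n)}_{u_n}$, $p^{(\omega)}_u=\prod_jp^{(\omega_j)}_{u_j}$. $\eta^{(\omega)}$ is the law of $\sum_{n\ge1}(\prod_{j<n}\lambda_{\omega_j})t^{(\omega_n)}_{u_n}$, $u_n$ independent with laws $p_{\omega_n}$. Fix $R>0$ with $\overline{f^{(i)}_j(B(0,R))}\subset B(0,R)$ and $2R\min r_i>1/2$; $B^{(\omega)}_u=f^{(\omega)}_u(B(0,R))$; $k'(\omega)$ is the natural number with $2R\prod_{i=1}^{k'}r_{\omega_i}\le2^{-k}\le2R\prod_{i=1}^{k'-1}r_{\omega_i}$.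 Raw component: $\mu_{x,i}=\mu|_D/\mu(D)$ for $D=D_i(x)$ the dyadic square of side $2^{-i}$ containing $x$; $\mathbf P_{i=k}(\mu_{x,i}\in A)=\mu(\{x:\mu_{x,k}\in A\})$. Truncated component: for $D\in\mathcal D_k$ and $n>k$, $\eta^{(\omega)}_{n,[D]}=Z^{-1}\sum_{u\in\mathbb X^{(\omega)}_n,\ B^{(\omega)}_u\subset D}p^{(\omega)}_uf^{(\omega)}_u\eta^{(T^n\omega)}$ with $Z$ normalizing, and $\eta^{(\omega)}_{n,[x,k]}=\eta^{(\omega)}_{n,[D_k(x)]}$. $\mu$ is $(C,\rho)$-Frostman on tubes if $\mu(B(W+x,r))\le Cr^\rho$ for all lines $W$ through $0$, $x\in\mathbb R^2$, $r>0$. *)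

(* Defs.v *)
From HB Require Import structures.
From mathcomp Require Import all_boot all_order all_algebra.
From mathcomp Require Import all_classical all_reals all_analysis.
Set Implicit Arguments. Unset Strict Implicit. Unset Printing Implicit Defensive.
Import Order.TTheory GRing.Theory Num.Theory.
Import numFieldNormedType.Exports.
Local Open Scope classical_set_scope.
Local Open Scope ring_scope.

Section Planar.
Variable R : realType.

(* The plane R^2 = C, points as pairs (real part, imaginary part). *)
Definition cmul (a b : R * R) : R * R :=
  (a.1 * b.1 - a.2 * b.2, a.1 * b.2 + a.2 * b.1).
Definition cadd (a b : R * R) : R * R := (a.1 + b.1, a.2 + b.2).
Definition cnorm (a : R * R) : R := Num.sqrt (a.1 ^+ 2 + a.2 ^+ 2).

Definition eball (c : R * R) (r : R) : set (R * R) :=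
  [set z | cnorm (z.1 - c.1, z.2 - c.2) < r].

Variable I : finType.
Variables (K : I -> nat) (lam : I -> R * R) (t : I -> nat -> R * R)
          (p : I -> nat -> R).

(* f^{(i)}_j (z) = lambda_i z + t^{(i)}_j  (maps indexed by j < K i) *)
Definition fmap (i : I) (j : nat) (z : R * R) : R * R :=
  cadd (cmul (lam i) z) (t i j).

Definition rr (i : I) : R := cnorm (lam i).

(* shift: (T^n omega)_j = omega_{j+n}; omega_1 of the paper is omega 0 *)
Definition shiftn (n : nat) (om : nat -> I) : nat -> I := fun j => om (j + n)%N.

Fixpoint words (om : nat -> I) (n : nat) : seq (seq nat) :=
  match n with
  | 0 => [:: [::]]
  | n'.+1 => [seq rcons s j | s <- words om n', j <- iota 0 (K (om n'))]
  end.

Fixpoint fword (om : nat -> I) (u : seq nat) (n : nat) : R * R -> R * R :=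
  match n with
  | 0 => id
  | n'.+1 => fun z => fword om u n' (fmap (om n') (nth 0%N u n') z)
  end.
Definition fu (om : nat -> I) (u : seq nat) := fword om u (size u).

Definition pu (om : nat -> I) (u : seq nat) : R :=
  \prod_(j < size u) p (om j) (nth 0%N u j).

Definition pe (i : I) (a : nat) : R := if (a < K i)%N then p i a else 0.

Fixpoint lamprod (om : nat -> I) (m : nat) : R * R :=
  match m with
  | 0 => (1, 0)
  | m'.+1 => cmul (lamprod om m') (lam (om m'))
  end.

Definition Yterm (om : nat -> I) (a : nat -> nat) (m : nat) : R * R :=
  cmul (lamprod om m) (t (om m) (a m)).
Definition Yseries (om : nat -> I) (a : nat -> nat) : R * R :=
  (limn (@series R (fun m => (Yterm om a m).1) : R^nat),
   limn (@series R (fun m => (Yterm om a m).2) : R^nat)).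

(* nu is eta^{(omega)}: the law of the random series, where u_1, u_2, ...
   are independent with laws p_{omega_1}, p_{omega_2}, ...  *)
Definition is_eta (om : nat -> I) (nu : set (R * R) -> \bar R) : Prop :=
  exists (d : measure_display) (T : measurableType d) (P : probability T R)
         (u : nat -> T -> nat),
    (forall n a, measurable [set x | u n x = a]) /\
    (forall n (a : nat -> nat),
        P [set x | forall j, (j < n)%N -> u j x = a j] =
        (\prod_(j < n) pe (om j) (a j))%:E) /\
    (forall A : set (R * R), measurable A ->
        nu A = P [set x | Yseries om (fun j => u j x) \in A]).

Definition is_kprime (Rad : R) (om : nat -> I) (k kp : nat) : Prop :=
  2 * Rad * \prod_(j < kp) rr (om j) <= 2 ^- k /\
  forall kq, (kq < kp)%N -> 2 ^- k < 2 * Rad * \prod_(j < kq) rr (om j).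

Definition line0 (w : R * R) : set (R * R) := [set (s * w.1, s * w.2) | s in [set: R]].
Definition tube (w x : R * R) (r : R) : set (R * R) :=
  [set y | exists2 z, z \in line0 w & y \in eball (cadd z x) r].
Definition frostman_tubes (C rho : R) (mu : set (R * R) -> \bar R) : Prop :=
  forall (w x : R * R) (r : R), w != (0, 0) -> 0 < r ->
    (mu (tube w x r) <= (C * r `^ rho)%:E)%E.

(* dyadic square of side 2^-i containing x (half-open [a,a+1)2^-i x [b,b+1)2^-i) *)
Definition dyadic (i : nat) (x : R * R) : set (R * R) :=
  [set y | Num.floor (y.1 * 2 ^+ i) = Num.floor (x.1 * 2 ^+ i) /\
           Num.floor (y.2 * 2 ^+ i) = Num.floor (x.2 * 2 ^+ i)].

(* raw component mu_D = mu|_D / mu(D)  (the zero set function if mu(D) = 0) *)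
Definition rawcomp (mu : set (R * R) -> \bar R) (D : set (R * R)) : set (R * R) -> R :=
  fun A => fine (mu (A `&` D)) / fine (mu D).

(* truncated component eta^{(omega)}_{n,[D]} (zero set function if Z = 0) *)
Definition trunccomp (eta : (nat -> I) -> set (R * R) -> \bar R) (Rad : R)
    (om : nat -> I) (n : nat) (D : set (R * R)) : set (R * R) -> R :=
  fun A =>
    (\sum_(u <- words om n | `[< fu om u @` eball (0, 0) Rad `<=` D >])
        pu om u * fine (eta (shiftn n om) (fu om u @^-1` A)))
    / (\sum_(u <- words om n | `[< fu om u @` eball (0, 0) Rad `<=` D >]) pu om u).

Definition dTV (mu nu : set (R * R) -> R) : R :=
  sup [set `|mu A - nu A| | A in [set A : set (R * R) | measurable A]].

Definition planar_model (Rad : R) : Prop :=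
  (forall i, (0 < K i)%N) /\
  (forall i, 0 < rr i < 1) /\
  (forall i, (forall j, (j < K i)%N -> 0 < p i j) /\ \sum_(j < K i) p i j = 1) /\
  0 < Rad /\
  (forall i j, (j < K i)%N ->
     closure (fmap i j @` eball (0, 0) Rad) `<=` eball (0, 0) Rad) /\
  (forall i, 1 / 2 < 2 * Rad * rr i).

End Planar.

(* Main.v *)
Require Import Defs.
From HB Require Import structures.
From mathcomp Require Import all_boot all_order all_algebra.
From mathcomp Require Import all_classical all_reals all_analysis.
From mathcomp Require Import measurable_realfun ring lra.
Import Order.TTheory GRing.Theory Num.Theory.
Import numFieldNormedType.Exports.
Local Open Scope classical_set_scope.
Local Open Scope ring_scope.
Set Implicit Arguments. Unset Strict Implicit. Unset Printing Implicit Defensive.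

(** Realize [eta om] as the image, under the coding map [Y], of the product law on
    digit sequences [b]. Writing [v_n] for the prefix of [b] of length [n], the
    truncated component of a dyadic square [D] is the law of [Y] conditioned on
    [B_(v_n) <= D], while the raw component is the law of [Y] conditioned on
    [Y \in D]. The first event is almost surely contained in the second, so the two
    conditional laws are at total variation distance at most
    [P(Y \in D, not B_(v_n) <= D) / P(Y \in D)]. By Markov's inequality over the cells,
    the bad squares have total mass at most
    [P(B_(v_n) meets two dyadic squares) / eps].

    A disc [B_(v_n)] meeting two squares crosses a grid line. The larger disc
    [B_(v_k')] has diameter at most [2^-k], so given [v_k'] there is only one candidate
    line per direction, and pulling the strip of width [2^-k * q^N] around it back by
    [f_(v_k')] gives a tube of width [O(q^N)], of measure [O(q^(N rho))] for
    [eta (T^k' om)] by the Frostman hypothesis and independence of the digits. *)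

(** * Complex arithmetic on the plane, tubes as strips, and nearby points in different unit cells *)

Section PlaneGeometry.
Context {R : realType}.
Implicit Types a b z : R * R.

Lemma cnorm_ge0 a : 0 <= cnorm a.
Proof. exact: sqrtr_ge0. Qed.

Lemma cnormM a b : cnorm (cmul a b) = cnorm a * cnorm b.
Proof.
rewrite /cnorm /cmul /= -sqrtrM; last by rewrite addr_ge0 ?sqr_ge0.
by congr Num.sqrt; ring.
Qed.

Lemma cnorm_fst_le a : `|a.1| <= cnorm a.
Proof.
by rewrite -sqrtr_sqr /cnorm ler_sqrt ?lerDl ?sqr_ge0 // addr_ge0 ?sqr_ge0.
Qed.

Lemma cnorm_snd_le a : `|a.2| <= cnorm a.
Proof.
by rewrite -sqrtr_sqr /cnorm ler_sqrt ?lerDr ?sqr_ge0 // addr_ge0 ?sqr_ge0.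
Qed.

Lemma in_eball0 z (r : R) : eball (0, 0) r z <-> cnorm z < r.
Proof. by rewrite /eball /= !subr0. Qed.

(** The vector [(a, b)] is normal to the line where the linear form vanishes, and the chosen centre
    is the foot of the perpendicular from the origin to that line. The Frostman hypothesis speaks of
    tubes, while the crossing estimate produces inequalities on linear forms; this identity joins
    the two. *)
Lemma tubeE (a b e d : R) : (a, b) != (0, 0) ->
  tube (- b, a) (- (e / (a ^+ 2 + b ^+ 2) * a), - (e / (a ^+ 2 + b ^+ 2) * b))
    (d / cnorm (a, b)) =
  [set y | `|a * y.1 + b * y.2 + e| < d].
Proof.
move=> ab0.
set n2 := a ^+ 2 + b ^+ 2.
have n2_gt0 : 0 < n2.
  rewrite lt0r addr_ge0 ?sqr_ge0// andbT paddr_eq0 ?sqr_ge0// !sqrf_eq0.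
  by apply: contra ab0 => /andP[/eqP -> /eqP ->].
have nab_gt0 : 0 < cnorm (a, b) by rewrite sqrtr_gt0.
have nabE : cnorm (a, b) ^+ 2 = n2 by rewrite sqr_sqrtr // ltW.
have n2_neq0 : n2 != 0 by rewrite gt_eqF.
apply/seteqP; split => y /=.
- move=> [z /set_mem [s _ <-]] /set_mem; rewrite /eball /=.
  set h1 := y.1 - _; set h2 := y.2 - _; rewrite ltr_pdivlMr // => hd.
  (* Multiplying the offset by the conjugate [(a, - b)] turns the linear form into a real part,
     which the modulus bounds. *)
  have -> : a * y.1 + b * y.2 + e = (cmul (a, - b) (h1, h2)).1.
    rewrite /cmul /h1 /h2 /=.
    have -> : e = e / n2 * n2 by rewrite divfK.
    by rewrite mulfK // /n2; ring.
  apply: le_lt_trans (cnorm_fst_le _) _; rewrite cnormM mulrC.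
  by rewrite [cnorm (a, - b)]/cnorm /= sqrrN.
- set g := a * y.1 + b * y.2 + e => gd.
  (* The witness is the component of [y] along the direction [(- b, a)] of the line. *)
  exists (((- b * y.1 + a * y.2) / n2) * - b, ((- b * y.1 + a * y.2) / n2) * a).
    by apply/mem_set; exists ((- b * y.1 + a * y.2) / n2).
  apply/mem_set; rewrite /eball /= ltr_pdivlMr //.
  have -> : (y.1 - ((- b * y.1 + a * y.2) / n2 * - b - e / n2 * a),
             y.2 - ((- b * y.1 + a * y.2) / n2 * a - e / n2 * b)) =
            cmul (g / n2, 0) (a, b).
    have y1 : y.1 = y.1 * n2 / n2 by rewrite mulfK.
    have y2 : y.2 = y.2 * n2 / n2 by rewrite mulfK.
    rewrite /cmul /= /g; congr pair.
      by rewrite [X in X - _]y1 /n2; ring.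
    by rewrite [X in X - _]y2 /n2; ring.
  rewrite cnormM -mulrA -expr2 nabE /cnorm /= expr0n /= addr0 sqrtr_sqr.
  by rewrite normrM normfV (gtr0_norm n2_gt0) divfK.
Qed.

(* Two points of a [1/2]-neighbourhood of [c] lying in different unit cells are
   separated by the only integer that the neighbourhood can contain. *)
Lemma floor_neq_dist (c x y r s : R) :
  s <= 1 / 2 -> `|x - c| < s -> `|y - c| < s -> `|x - y| < r ->
  Num.floor x <> Num.floor y ->
  `|x - (Num.floor (c + 1 / 2))%:~R| < r.
Proof.
move=> s1.
(* The integer [floor v] lies in [(u, v]], hence strictly within [1 / 2] of [c], which forces it to
   be [floor (c + 1 / 2)]. *)
have key u v : `|u - c| < s -> `|v - c| < s -> Num.floor u < Num.floor v ->
    u < (Num.floor (c + 1 / 2))%:~R <= v.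
  rewrite !ltr_norml => /andP[u1 u2] /andP[v1 v2] uv.
  have uv' : (Num.floor u + 1)%:~R <= (Num.floor v)%:~R :> R.
    by rewrite ler_int lezD1.
  have um := lt_le_trans (floorD1_gt u) uv'.
  have mv := floor_le v.
  rewrite (@floor_def _ _ (Num.floor v)) ?um // intrD.
  by apply/andP; split; lra.
move=> xc yc; rewrite !ltr_norml => /andP[xy1 xy2] /eqP fxy.
have [l|l|l] := ltgtP (Num.floor x) (Num.floor y); last by rewrite l eqxx in fxy.
- by have /andP[h1 h2] := key _ _ xc yc l; apply/andP; split; lra.
- by have /andP[h1 h2] := key _ _ yc xc l; apply/andP; split; lra.
Qed.

End PlaneGeometry.

(** * The coding map and its self-similarity *)

Section CodingMap.
Context {R : realType} {I : finType}.
Variables (K : I -> nat) (lam : I -> R * R) (t : I -> nat -> R * R)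
          (p : I -> nat -> R) (Rad : R).
Hypothesis model : planar_model K lam t p Rad.
Implicit Types (om : nat -> I) (a : nat -> nat).

Lemma contraction_ratio_uniform : exists2 q : R, 0 < q < 1 & forall i, rr lam i <= q.
Proof.
have [_ [rr01 _]] := model.
(* Starting the maximum at [1 / 2] keeps it strictly between 0 and 1 whatever the finite index set
   is. *)
exists (\big[Num.max/(1 / 2)]_i rr lam i).
  apply/andP; split.
    apply: (@big_ind _ (fun x : R => 0 < x)) => [|x y x0 y0|i _].
    - lra.
    - by rewrite lt_max x0.
    - by case/andP: (rr01 i).
  apply: (@big_ind _ (fun x : R => x < 1)) => [|x y x0 y0|i _].
  - lra.
  - by rewrite gt_max x0.
  - by case/andP: (rr01 i).
by move=> i; apply: le_bigmax.
Qed.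

Lemma fmap_eball i j z : (j < K i)%N -> eball (0, 0) Rad z ->
  eball (0, 0) Rad (Defs.fmap lam t i j z).
Proof.
by have [_ [_ [_ [_ [H _]]]]] := model => jK zB; apply: (H i j jK); apply: subset_closure; exists z.
Qed.

Lemma eball00 : eball (0, 0) Rad (0, 0).
Proof.
have [_ [_ [_ [Rad_gt0 _]]]] := model.
by apply/in_eball0; rewrite /cnorm /= expr0n /= addr0 sqrtr0.
Qed.

Lemma fmap0 i j : Defs.fmap lam t i j (0, 0) = t i j.
Proof.
by rewrite /Defs.fmap /Defs.cadd /cmul /=; case: (t i j) => x y /=; congr pair => /=; ring.
Qed.

Lemma translation_norm_le i j : (j < K i)%N -> cnorm (t i j) <= Rad.
Proof.
move=> jK; have := fmap_eball jK eball00.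
by rewrite fmap0 => /in_eball0/ltW.
Qed.

Lemma fword_eq om u v n : (forall j, (j < n)%N -> nth 0%N u j = nth 0%N v j) ->
  fword lam t om u n =1 fword lam t om v n.
Proof.
elim: n => //= n IH uv z; rewrite uv // IH // => j jn.
by rewrite uv // ltnW.
Qed.

(** The composition along the first [n] digits, taken as a function of an infinite code so that
    prefixes of different lengths can be compared. *)
Definition fprefix om a n := fword lam t om (mkseq a n) n.

Lemma fprefixS om a n z :
  fprefix om a n.+1 z = fprefix om a n (Defs.fmap lam t (om n) (a n) z).
Proof.
rewrite /fprefix /= nth_mkseq //; apply: fword_eq => j jn.
by rewrite !nth_mkseq // ltnW.
Qed.

Lemma fprefix_affine om a n z : fprefix om a n z =
  Defs.cadd (fprefix om a n (0, 0)) (cmul (lamprod lam om n) z).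
Proof.
elim: n z => [|n IH] z.
  by rewrite /fprefix /Defs.cadd /cmul /=; case: z => x y /=; congr pair => /=; ring.
rewrite !fprefixS IH [in RHS]IH /Defs.fmap /Defs.cadd /cmul /=.
by congr pair => /=; ring.
Qed.

Lemma fprefixD om a m n z : fprefix om a (m + n) z =
  fprefix om a m (fprefix (shiftn m om) (fun j => a (j + m)%N) n z).
Proof.
elim: n z => [|n IH] z; first by rewrite addn0.
by rewrite addnS !fprefixS IH /shiftn (addnC n).
Qed.

Lemma cnorm_lamprod om n : cnorm (lamprod lam om n) = \prod_(j < n) rr lam (om j).
Proof.
elim: n => [|n IH].
  by rewrite big_ord0 /cnorm /= expr1n expr0n addr0 sqrtr1.
by rewrite /= cnormM IH big_ord_recr.
Qed.

Lemma fprefix_fst_dist om a n z : eball (0, 0) Rad z ->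
  `|(fprefix om a n z).1 - (fprefix om a n (0, 0)).1| <
    Rad * \prod_(j < n) rr lam (om j).
Proof.
move=> /in_eball0 zB; have [_ [rr01 _]] := model.
have pr_gt0 : 0 < \prod_(j < n) rr lam (om j).
  by apply: prodr_gt0 => j _; case/andP: (rr01 (om j)).
rewrite fprefix_affine /= addrAC subrr add0r.
apply: le_lt_trans (cnorm_fst_le (cmul (lamprod lam om n) z)) _.
by rewrite cnormM cnorm_lamprod mulrC ltr_pM2r.
Qed.

Lemma fprefix_snd_dist om a n z : eball (0, 0) Rad z ->
  `|(fprefix om a n z).2 - (fprefix om a n (0, 0)).2| <
    Rad * \prod_(j < n) rr lam (om j).
Proof.
move=> /in_eball0 zB; have [_ [rr01 _]] := model.
have pr_gt0 : 0 < \prod_(j < n) rr lam (om j).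
  by apply: prodr_gt0 => j _; case/andP: (rr01 (om j)).
rewrite fprefix_affine /= addrAC subrr add0r.
apply: le_lt_trans (cnorm_snd_le (cmul (lamprod lam om n) z)) _.
by rewrite cnormM cnorm_lamprod mulrC ltr_pM2r.
Qed.

Definition admissible om a := forall j, (a j < K (om j))%N.

Lemma admissible_shift om a m : admissible om a ->
  admissible (shiftn m om) (fun j => a (j + m)%N).
Proof. by move=> H j; apply: H. Qed.

Lemma fprefix_eball om a n z : admissible om a -> eball (0, 0) Rad z ->
  eball (0, 0) Rad (fprefix om a n z).
Proof.
move=> aK; elim: n z => // n IH z zB.
by rewrite fprefixS; apply/IH/fmap_eball.
Qed.

Lemma fprefix0E om a n : fprefix om a n (0, 0) =
  (series (fun m => (Yterm lam t om a m).1) n,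
   series (fun m => (Yterm lam t om a m).2) n).
Proof.
elim: n => [|n IH]; first by rewrite /series /= !big_geq.
rewrite fprefixS fmap0 fprefix_affine IH.
by rewrite /series /= !big_nat_recr.
Qed.

(** Each translation is the image of the origin under a map preserving the ball, so its norm is at
    most [Rad]; the terms are then dominated by the geometric series [Rad * q ^+ m]. *)
Lemma Yseries_cvg om a : admissible om a ->
  fprefix om a n (0, 0) @[n --> \oo] --> Yseries lam t om a.
Proof.
move=> aK; have [q /andP[q_gt0 q_lt1] rrq] := contraction_ratio_uniform.
have [_ [rr01 [_ [Rad_gt0 _]]]] := model.
have Yn m : cnorm (Yterm lam t om a m) <= geometric Rad q m.
  rewrite /Yterm cnormM cnorm_lamprod /= mulrC.
  apply: ler_pM; rewrite ?cnorm_ge0 ?translation_norm_le //.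
    by apply: prodr_ge0 => j _; apply: cnorm_ge0.
  rewrite -[m in X in _ <= X]card_ord -prodr_const.
  by apply: ler_prod => j _; rewrite rrq cnorm_ge0.
have geo : cvgn (series (geometric Rad q)).
  by apply: is_cvg_geometric_series; rewrite gtr0_norm.
under eq_cvg do rewrite fprefix0E.
apply: (@cvg_pair _ _ _ _ (nbhs _) (nbhs _)); apply: normed_cvg;
  apply: series_le_cvg geo => m /=.
- exact: normr_ge0.
- by rewrite mulr_ge0 ?exprn_ge0 // ltW.
- exact: le_trans (cnorm_fst_le _) (Yn m).
- exact: normr_ge0.
- by rewrite mulr_ge0 ?exprn_ge0 // ltW.
- exact: le_trans (cnorm_snd_le _) (Yn m).
Qed.

Lemma fprefix_continuous om a n : continuous (fprefix om a n).
Proof.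
move=> z; rewrite /continuous_at.
under eq_cvg do rewrite fprefix_affine.
rewrite fprefix_affine /Defs.cadd /cmul /=.
by apply: (@cvg_pair _ _ _ _ (nbhs _) (nbhs _)) => /=; apply: cvgD; (try exact: cvg_cst);
  [apply: cvgB|apply: cvgD]; apply: cvgMr;
  first [exact: cvg_fst|exact: cvg_snd].
Qed.

(** Let the second length tend to infinity in [fprefixD]: the prefix map of length [m] is continuous
    and passes through the limit. *)
Lemma Yseries_shift om a m : admissible om a ->
  Yseries lam t om a =
  fprefix om a m (Yseries lam t (shiftn m om) (fun j => a (j + m)%N)).
Proof.
move=> aK; have cY := cvg_comp _ _ (cvg_addnr m) (Yseries_cvg aK).
have := Yseries_cvg (admissible_shift m aK).
move=> /(continuous_cvg _ (@fprefix_continuous om a m _)) cY'.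
apply: (cvg_unique _ cY) => //.
move=> /=; have -> // : (fprefix om a)^~ (0, 0) \o addn^~ m = (fprefix om a m \o
  (fprefix (shiftn m om) (fun j => a (j + m)%N))^~ (0, 0)).
by apply/funext => n /=; rewrite addnC fprefixD.
Qed.

(** A limit of points of an open ball could fall on its boundary. Here the approximating points lie
    in the image of the ball under the first map, and the closure of that image is inside the open
    ball. *)
Lemma Yseries_eball om a : admissible om a -> eball (0, 0) Rad (Yseries lam t om a).
Proof.
move=> aK; have [_ [_ [_ [_ [H _]]]]] := model.
apply: (H (om 0%N) (a 0%N) (aK 0%N)).
have cY := cvg_comp _ _ (cvg_addnr 1) (Yseries_cvg aK).
apply: (closed_cvg _ _ _ _ cY); first exact: closed_closure.
near=> n; apply: subset_closure; rewrite /= addnC fprefixD.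
eexists; last by rewrite fprefixS.
exact: fprefix_eball (admissible_shift 1 aK) eball00.
Unshelve. all: by end_near. Qed.
End CodingMap.

(** * Measurability of pointwise limits that may fail to exist *)

Section MeasurableLimit.
Context {d : measure_display} {T : measurableType d} {R : realType}.

(** The Cauchy criterion written with countable quantifiers only, so that the set of convergence
    becomes a countable combination of measurable sets. *)
Lemma cvgn_natSinvP (h : R^nat) : cvgn h <->
  forall k, exists N, forall n, (N <= n)%N -> `|h N - h n| < k.+1%:R^-1.
Proof.
split=> [hc k|H].
  have k0 : 0 < k.+1%:R^-1 / 2 :> R by rewrite divr_gt0 ?invr_gt0.
  have [N _ HN] := cvgr_dist_lt h (limn h) hc _ k0.
  exists N => n Nn; rewrite -(subrKA (limn h)).
  apply: le_lt_trans (ler_normD _ _) _.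
  by rewrite [ltRHS](splitr k.+1%:R^-1) distrC ltrD // HN //=.
apply: cauchy_cvg; apply: cauchy_exP => e e0.
have [k ke] := ltr_add_invr e0.
have [N HN] := H k; exists (h N), N => // n Nn /=.
by apply: lt_trans (HN n Nn) _; rewrite add0r in ke.
Qed.

Lemma measurable_fun_limn (h : nat -> T -> R) :
  (forall n, measurable_fun setT (h n)) ->
  measurable_fun setT (fun x => limn (h^~ x)).
Proof.
move=> mh; pose C := [set x | cvgn (h^~ x)].
have mC : measurable C.
  have -> : C = \bigcap_k \bigcup_N \bigcap_n
      [set x | (N <= n)%N -> `|h N x - h n x| < k.+1%:R^-1].
    apply/seteqP; split=> x.
      by move=> /cvgn_natSinvP H k _; have [N HN] := H k; exists N => // n _; apply: HN.
    by move=> H; apply/cvgn_natSinvP => k; have [N _ HN] := H k I; exists N => n; apply: HN.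
  apply: bigcapT_measurable => k; apply: bigcupT_measurable => N.
  apply: bigcapT_measurable => n.
  have [Nn|Nn] := boolP (N <= n)%N; last first.
    by rewrite [X in measurable X](_ : _ = setT) //; apply/seteqP; split.
  rewrite [X in measurable X](_ : _ = setT `&` (fun x => `|h N x - h n x| < k.+1%:R^-1) @^-1` [set true]).
    apply: measurable_fun_ltr => //.
    apply: measurableT_comp; first exact: normr_measurable.
    exact: measurable_funB.
  by rewrite setTI; apply/seteqP; split=> x /=; [apply|move=> -> ].
(* On a divergent sequence [limn] returns the default value [point]; with this constant off [C], the
   functions [h'] converge everywhere to the required limit. *)
pose h' n x := if x \in C then h n x else point.
apply: (@measurable_fun_cvg _ _ _ _ h').
  move=> n; apply: measurable_fun_ifT => //.
  by apply: (measurable_fun_bool true); rewrite setTI preimage_mem_true.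
move=> x _; rewrite /h'; have [xC|xC] := pselect (C x).
  by rewrite mem_set.
by rewrite memNset // dvgP //; exact: cvg_cst.
Qed.

End MeasurableLimit.

(** * The measurable space of digit sequences *)

Definition cylinder (n : nat) (a : nat -> nat) : set (nat -> nat) :=
  [set b | forall j, (j < n)%N -> b j = a j].

(** The empty set is included to make the family stable under intersection, as uniqueness of
    measures on a generating family requires. *)
Definition cylinders : set (set (nat -> nat)) :=
  [set A | A = set0 \/ exists n a, A = cylinder n a].

Local Notation codes := (g_sigma_algebraType cylinders).

Lemma cylinders_setI_closed : setI_closed cylinders.
Proof.
suff H n m a b : (n <= m)%N -> cylinders (cylinder n a `&` cylinder m b).
  move=> _ _ [->|[n [a ->]]] [->|[m [b ->]]]; rewrite ?set0I ?setI0; try by left.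
  by have [|/ltnW] := leqP n m => /H //; rewrite setIC.
move=> nm; have [ab|ab] := pselect (forall j, (j < n)%N -> b j = a j).
  right; exists m, b; apply/seteqP; split=> [c []//|c cb]; split=> // j jn.
  by rewrite -ab // cb // (leq_trans jn).
left; apply/seteqP; split=> // c [ca cb]; apply: ab => j jn.
by rewrite -ca // cb // (leq_trans jn).
Qed.

Lemma measurable_cylinder n a : measurable (cylinder n a : set codes).
Proof. by apply: sub_sigma_algebra; right; exists n, a. Qed.

(** There are countably many finite words, and the codes with a given prefix form a cylinder, or the
    empty set if the word has the wrong length. *)
Lemma measurable_prefix_set n (Q : set (seq nat)) :
  measurable ([set b | Q (mkseq b n)] : set codes).
Proof.
have -> : [set b | Q (mkseq b n)] = \bigcup_k
    oapp (fun s => [set b | Q s /\ mkseq b n = s]) set0 (unpickle k).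
  apply/seteqP; split=> b.
    by move=> Qb; exists (pickle (mkseq b n)) => //; rewrite pickleK.
  by move=> [k _]; case: unpickle => [s|//] [Qs bs]; rewrite /mkset bs.
apply: bigcupT_measurable => k; case: (unpickle k) => [s|] //=.
have [[Qs sn]|nQ] := pselect (Q s /\ size s = n).
  rewrite [X in measurable X](_ : _ = cylinder n (nth 0%N s)).
    exact: measurable_cylinder.
  apply/seteqP; split=> b /=.
    by move=> [_ <-] j jn; rewrite nth_mkseq.
  move=> bs; split=> //; apply: (@eq_from_nth _ 0%N); rewrite size_mkseq // => j jn.
  by rewrite nth_mkseq // bs.
rewrite [X in measurable X](_ : _ = set0) //.
by apply/seteqP; split=> // b [Qs bs]; apply: nQ; rewrite -bs size_mkseq bs.
Qed.

Lemma measurable_fun_prefix (d : measure_display) (X : measurableType d) n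
  (F : seq nat -> X) : measurable_fun setT (fun b : codes => F (mkseq b n)).
Proof. by move=> _ A mA; rewrite setTI; apply: (@measurable_prefix_set n (F @^-1` A)). Qed.

Lemma measurable_fun_codes (d : measure_display) (T : measurableType d)
    (u : nat -> T -> nat) : (forall n a, measurable [set x | u n x = a]) ->
  measurable_fun setT ((fun x j => u j x) : T -> codes).
Proof.
move=> mu; apply: (@measurability _ _ T codes setT (fun x j => u j x) cylinders) => //.
move=> _ [A [->|[n [a ->]]] <-]; rewrite setTI ?preimage_set0 //.
elim: n => [|n IH].
  by rewrite [X in measurable X](_ : _ = setT) //; apply/seteqP; split.
rewrite [X in measurable X](_ : _ = (fun x j => u j x) @^-1` cylinder n a `&` [set x | u n x = a n]).
  exact: measurableI.
apply/seteqP; split=> x /=.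
  by move=> H; split; [move=> j jn; apply: H; exact: ltnW|apply: H].
by move=> [H1 H2] j; rewrite ltnS leq_eqVlt => /orP[/eqP ->|]//; apply: H1.
Qed.

Definition shift_code (k : nat) (b : nat -> nat) : nat -> nat := fun j => b (j + k)%N.

Lemma measurable_shift_code k : measurable_fun setT (shift_code k : codes -> codes).
Proof.
apply: (@measurable_fun_codes _ codes (fun n b => b (n + k)%N)) => n a.
rewrite [X in measurable X](_ : _ =
  [set b | [set s | nth 0%N s (n + k) = a] (mkseq b (n + k).+1)]).
  exact: measurable_prefix_set.
by apply/seteqP; split=> b /=; rewrite nth_mkseq.
Qed.

(** Both sides are measures in [A]: the pushforward of a restriction, and a multiple of [m']. They
    agree on the intersection-stable family of cylinders, hence on the sigma-algebra it
    generates. *)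
Lemma prefix_shift_unique (R : realType) (m m' : {measure set codes -> \bar R})
    (k : nat) (v : nat -> nat) (c : R) :
  (m setT < +oo)%E -> 0 <= c ->
  (forall n a, m (cylinder k v `&` shift_code k @^-1` cylinder n a) =
    (c%:E * m' (cylinder n a))%E) ->
  forall A : set codes, measurable A ->
    m (cylinder k v `&` shift_code k @^-1` A) = (c%:E * m' A)%E.
Proof.
move=> mT c0 cyl A mA.
pose m1 : measure codes R :=
  measure_function_pushforward__canonical__measure_function_Measure
    (mrestr m (measurable_cylinder k v)) (@measurable_shift_code k).
pose m2 : measure codes R := mscale (NngNum c0) m'.
have m1E B : m1 B = m (cylinder k v `&` shift_code k @^-1` B).
  by rewrite /m1 /= /pushforward /mrestr setIC.
have m2E B : m2 B = (c%:E * m' B)%E by [].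
rewrite -m1E -m2E.
(* The whole space is the cylinder of length 0 and has finite mass, so a constant sequence serves as
   the exhaustion. *)
apply: (@measure_unique _ _ codes cylinders (fun=> setT)) => //.
- exact: cylinders_setI_closed.
- by move=> _; right; exists 0%N, (fun=> 0%N); apply/seteqP; split.
- by rewrite bigcup_const //; exists 0%N.
- by move=> _ [->|[n [a ->]]]; rewrite ?measure0 // m1E m2E cyl.
- move=> _; rewrite m1E; apply: le_lt_trans mT.
  rewrite setIT; apply: le_measure => //; rewrite inE //; exact: measurable_cylinder.
Qed.

(** * The product law on codes and the independence of prefix and tail *)

Section CodeLaw.
Context {R : realType} {I : finType}.
Variables (K : I -> nat) (lam : I -> R * R) (t : I -> nat -> R * R)
          (p : I -> nat -> R).
Implicit Types (om : nat -> I) (a b v : nat -> nat).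

(** The product measure is characterized by its cylinder masses; the weights [pe] vanish on digits
    outside the alphabet. *)
Definition code_law om (m : {measure set codes -> \bar R}) :=
  forall n a, m (cylinder n a) = (\prod_(j < n) pe K p (om j) (a j))%:E.

Lemma measurable_Yseries om :
  measurable_fun setT (Yseries lam t om : codes -> (R * R)%type).
Proof.
apply: measurable_fun_pair; apply: measurable_fun_limn => n.
  rewrite [X in measurable_fun _ X](_ : _ =
      (fun b : codes => (fword lam t om (mkseq b n) n (0, 0)).1)).
    exact: (@measurable_fun_prefix _ _ n (fun s => (fword lam t om s n (0, 0)).1)).
  by apply/funext => b; rewrite -[fword _ _ _ _ _ _]/(fprefix lam t om b n (0, 0)) fprefix0E.
rewrite [X in measurable_fun _ X](_ : _ =
    (fun b : codes => (fword lam t om (mkseq b n) n (0, 0)).2)).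
  exact: (@measurable_fun_prefix _ _ n (fun s => (fword lam t om s n (0, 0)).2)).
by apply/funext => b; rewrite -[fword _ _ _ _ _ _]/(fprefix lam t om b n (0, 0)) fprefix0E.
Qed.

Lemma measurable_Yseries_preimage om (A : set (R * R)) : measurable A ->
  measurable (Yseries lam t om @^-1` A : set codes).
Proof.
by move=> mA; rewrite -[X in measurable X]setTI; apply: measurable_Yseries.
Qed.

(** Push the abstract probability forward by its digit sequence. From here on all events live on the
    canonical space of codes. *)
Lemma is_eta_code_law om nu : is_eta K lam t p om nu ->
  exists2 m, code_law om m &
    forall A, measurable A -> nu A = m (Yseries lam t om @^-1` A).
Proof.
move=> [d [T [P [u [mu [lawu nuE]]]]]].
exists (measure_function_pushforward__canonical__measure_function_Measure P
  (measurable_fun_codes mu)).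
  by move=> n a; rewrite /= /pushforward -lawu.
move=> A mA; rewrite nuE // /= /pushforward; congr (P _).
by apply/seteqP; split=> x /=; [move=> /set_mem|move=> /mem_set].
Qed.

Variables (om : nat -> I) (m : {measure set codes -> \bar R}).
Hypothesis mlaw : code_law om m.

Lemma code_lawT : m setT = 1%E.
Proof.
have := mlaw 0 (fun=> 0%N); rewrite big_ord0 => <-; congr (m _).
by apply/seteqP; split.
Qed.

Lemma code_law_le1 A : measurable A -> (m A <= 1)%E.
Proof. by move=> mA; rewrite -code_lawT; apply: le_measure; rewrite ?inE. Qed.

Lemma code_law_fin A : measurable A -> m A \is a fin_num.
Proof.
move=> mA; rewrite ge0_fin_numE //.
by apply: le_lt_trans (code_law_le1 mA) (ltry _).
Qed.

Lemma measurable_admissible : measurable (admissible K om : set codes).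
Proof.
rewrite [X in measurable X](_ : _ = \bigcap_j [set b |
  [set s | (nth 0 s j < K (om j))%N] (mkseq b j.+1)]).
  by apply: bigcapT_measurable => j; exact: measurable_prefix_set.
apply/seteqP; split=> b H j; have := H j; rewrite /= nth_mkseq //; exact.
Qed.

(** An inadmissible code has a prefix containing a forbidden digit. The cylinder of such a prefix
    has a zero factor in its mass, and there are countably many of them. *)
Lemma admissible_full : m (~` admissible K om) = 0%E.
Proof.
pose F s : set codes := if [exists j : 'I_(size s), (K (om j) <= nth 0 s j)%N]
  then cylinder (size s) (nth 0%N s) else set0.
have F0 s : m (F s) = 0%E.
  rewrite /F; case: ifPn => [/existsP[j Kj]|_]; last exact: measure0.
  by rewrite mlaw (bigD1 j) //= /pe ltnNge Kj mul0r.
have mF s : measurable (F s).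
  by rewrite /F; case: ifPn => // _; exact: measurable_cylinder.
suff : m.-negligible (~` admissible K om).
  by move/measure_negligible; apply; apply: measurableC; exact: measurable_admissible.
apply: (@negligibleS _ _ _ _ (\bigcup_i oapp F set0 (unpickle i))); last first.
  apply: negligible_bigcup => i; case: (unpickle i) => [s|] /=.
    by exists (F s); split.
  exact: negligible_set0.
move=> b /existsNP[j /negP]; rewrite -leqNgt => Kj.
exists (pickle (mkseq b j.+1)) => //; rewrite pickleK.
rewrite -[oapp _ _ _]/(F (mkseq b j.+1)) /F.
have Hj : (j < size (mkseq b j.+1))%N by rewrite size_mkseq.
case: ifPn => [_|/existsPn/(_ (Ordinal Hj))]; last by rewrite nth_mkseq // Kj.
by rewrite size_mkseq => i ij; rewrite nth_mkseq.
Qed.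

Lemma code_law_admissible (A : set codes) : measurable A -> m (A `&` admissible K om) = m A.
Proof.
move=> mA; have mad := measurable_admissible.
apply/eqP; rewrite eq_le; apply/andP; split.
  by apply: le_measure; rewrite ?inE //; exact: measurableI.
have AE : A = (A `&` admissible K om) `|` (A `&` ~` admissible K om).
  by rewrite -setIUr setUv setIT.
rewrite [in leLHS]AE; apply: le_trans (measureU2 _ _ _) _.
- exact: measurableI.
- by apply: measurableI => //; exact: measurableC.
rewrite -[leRHS]adde0 leeD2l // -admissible_full.
by apply: le_measure; rewrite ?inE //; [apply: measurableI|]; rewrite //; exact: measurableC.
Qed.

(** Independence of the first [k] digits from the rest: prescribing the prefix [v] and then a
    cylinder for the tail is prescribing one longer cylinder, whose mass factors. *)
Lemma code_law_shift k v m' : code_law (shiftn k om) m' ->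
  forall A : set codes, measurable A ->
  m (cylinder k v `&` shift_code k @^-1` A) =
    ((\prod_(j < k) pe K p (om j) (v j))%:E * m' A)%E.
Proof.
move=> m'law; apply: prefix_shift_unique.
- by rewrite code_lawT ltry.
- by rewrite -lee_fin -mlaw.
move=> n a; rewrite m'law.
pose w j := if (j < k)%N then v j else a (j - k)%N.
have -> : cylinder k v `&` shift_code k @^-1` cylinder n a = cylinder (k + n) w.
  apply/seteqP; split=> b /=.
    move=> [bv ba] j jkn; rewrite /w; case: ltnP => [|kj]; first exact: bv.
    by rewrite -ba /shift_code ?subnK // ltn_subLR.
  move=> bw; split=> j jn; first by rewrite bw /w ?jn // ltn_addr.
  by rewrite /shift_code bw /w 1?addnC ?ltn_add2l // ltnNge leq_addr /= addKn.
rewrite mlaw big_split_ord /= -EFinM; congr (_ * _)%:E.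
  by apply: eq_bigr => j _; rewrite /w /= ltn_ord.
apply: eq_bigr => j _; rewrite /w /shiftn /=.
by rewrite ltnNge leq_addr /= addKn addnC.
Qed.

Lemma sum_prefix (E : set codes) n (s : seq (seq nat)) : measurable E -> uniq s ->
  m (E `&` [set b | mkseq b n \in s]) =
    (\sum_(w <- s) m (E `&` [set b | mkseq b n = w]))%E.
Proof.
move=> mE; elim: s => [_|w s IH /= /andP[ws us]].
  rewrite big_nil [X in m X](_ : _ = set0) ?measure0 //.
  by apply/seteqP; split=> b // [_].
rewrite big_cons -IH // -measureU.
- congr (m _); apply/seteqP; split=> b /=.
    by move=> [Eb]; rewrite in_cons => /orP[/eqP ?|?]; [left|right].
  by move=> [[Eb <-]|[Eb bs]]; split=> //; rewrite in_cons ?eqxx // bs orbT.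
- by apply: measurableI => //; exact: (@measurable_prefix_set n [set w]).
- by apply: measurableI => //; exact: (@measurable_prefix_set n [set x | x \in s]).
- by apply/seteqP; split=> b //= [[_ bw] [_]]; rewrite bw (negbTE ws).
Qed.

End CodeLaw.

(** * Finite words over the alphabets *)

Section Words.
Context {R : realType} {I : finType}.
Variables (K : I -> nat) (p : I -> nat -> R).
Implicit Types (om : nat -> I).

Lemma mem_words om n w : (w \in words K om n) =
  (size w == n) && [forall j : 'I_n, (nth 0 w j < K (om j))%N].
Proof.
apply/idP/andP.
  elim: n w => [w|n IH w] /=.
    by rewrite inE => /eqP ->; split=> //; apply/forallP => -[].
  move=> /allpairsP[[s j] /= [/IH[/eqP sn /forallP H]]].
  rewrite mem_iota add0n /= => jK ->; split; first by rewrite size_rcons sn.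
  apply/forallP => -[i /=]; rewrite ltnS leq_eqVlt nth_rcons sn => /orP[/eqP ->|iN].
    by rewrite ltnn eqxx.
  by rewrite iN; apply: (H (Ordinal iN)).
elim: n w => [w [/eqP/size0nil -> _]|n IH w [/eqP sw /forallP H]] //=.
case/lastP: w sw H => // s j; rewrite size_rcons => -[sn] H.
apply/allpairsP; exists (s, j); split=> //=.
  apply: IH; split; first exact/eqP.
  apply/forallP => i; have := H (widen_ord (leqnSn n) i).
  by rewrite /= nth_rcons sn ltn_ord.
by rewrite mem_iota add0n /=; have := H ord_max; rewrite /= nth_rcons sn ltnn eqxx.
Qed.

Lemma words_uniq om n : uniq (words K om n).
Proof.
elim: n => //= n IH; apply: allpairs_uniq => //; first exact: iota_uniq.
by move=> [s i] [s' i'] _ _ /= /rcons_inj[-> ->].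
Qed.

Lemma pu_words om n w : w \in words K om n ->
  pu p om w = \prod_(j < n) pe K p (om j) (nth 0%N w j).
Proof.
rewrite mem_words => /andP[/eqP <- /forallP H].
by apply: eq_bigr => j _; rewrite /pe H.
Qed.

Lemma mkseq_words om n b : admissible K om b -> mkseq b n \in words K om n.
Proof.
move=> bK; rewrite mem_words size_mkseq eqxx /=; apply/forallP => j.
by rewrite nth_mkseq.
Qed.

End Words.

(** * Measurable strips, countable partitions, and a comparison of conditional probabilities *)

Lemma measurable_affine (R : realType) (a b e : R) :
  measurable_fun setT (fun y : R * R => a * y.1 + b * y.2 + e).
Proof.
apply: measurable_funD => //; apply: measurable_funD.
  by apply: measurable_funM => //; exact: measurable_fst.
by apply: measurable_funM => //; exact: measurable_snd.
Qed.

Lemma measurable_strip (R : realType) (a b e d : R) :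
  measurable [set y : R * R | `|a * y.1 + b * y.2 + e| < d].
Proof.
rewrite [X in measurable X](_ : _ = setT `&`
  (fun y : R * R => `|a * y.1 + b * y.2 + e| < d) @^-1` [set true]).
  apply: measurable_fun_ltr => //.
  apply: measurableT_comp; first exact: normr_measurable.
  exact: measurable_affine.
by rewrite setTI; apply/seteqP; split=> x.
Qed.

Lemma measurable_countable_preimage (d : measure_display) (T : measurableType d)
    (Z : countType) (c : T -> Z) (B : set Z) :
  (forall z, measurable (c @^-1` [set z])) -> measurable (c @^-1` B).
Proof.
move=> mc; have -> : c @^-1` B = \bigcup_i
    oapp (fun z => if z \in B then c @^-1` [set z] else set0) set0 (unpickle i).
  apply/seteqP; split=> x.
    by move=> Bx; exists (pickle (c x)) => //; rewrite pickleK /= mem_set.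
  move=> [i _]; case: (unpickle i) => [z|//] /=.
  by case: ifPn => // /set_mem Bz /= ->.
apply: bigcupT_measurable => i; case: (unpickle i) => [z|] //=.
by case: ifP.
Qed.

Section MeasureUnions.
Context {d : measure_display} {T : measurableType d} {R : realType}.
Variable m : {measure set T -> \bar R}.

Lemma measure_bigsetU_le (J : eqType) (s : seq J) (F : J -> set T) :
  (forall j, measurable (F j)) ->
  (m (\big[setU/set0]_(j <- s) F j) <= \sum_(j <- s) m (F j))%E.
Proof.
move=> mF; elim: s => [|j s IH]; first by rewrite !big_nil measure0.
rewrite !big_cons; apply: le_trans (measureU2 _ _ _) _ => //.
  exact: bigsetU_measurable.
exact: leeD2l.
Qed.

(** Markov's inequality for a countable partition: add the hypothesis over the disjoint bad cells
    and bound the total by the mass of [S]. *)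
Lemma measure_bad_cells_le (Z : countType) (c : T -> Z) (bad : set Z) (S : set T)
    (eps : R) : 0 <= eps ->
  (forall z, measurable (c @^-1` [set z])) -> measurable S ->
  (forall z, bad z ->
    (eps%:E * m (c @^-1` [set z]) <= m (c @^-1` [set z] `&` S))%E) ->
  (eps%:E * m (c @^-1` bad) <= m S)%E.
Proof.
move=> eps0 mc mS H.
pose G z : set T := if z \in bad then c @^-1` [set z] else set0.
(* The exact partial inverse [pickle_inv] lists every cell at one index only, which makes the family
   disjoint. *)
pose F (i : nat) := oapp G set0 (pickle_inv i).
have mG z : measurable (G z) by rewrite /G; case: ifP.
have mF i : measurable (F i) by rewrite /F; case: (pickle_inv i) => [z|] /=.
have FE : c @^-1` bad = \bigcup_i F i.
  apply/seteqP; split=> x.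
    move=> bx; exists (pickle (c x)) => //.
    by rewrite /F pickleK_inv /= /G mem_set.
  move=> [i _]; rewrite /F; case: (pickle_inv i) => [z|//] /=.
  by rewrite /G; case: ifPn => // /set_mem bz /= ->.
have tF : trivIset setT F.
  apply/trivIsetP => i j _ _ ij; apply/seteqP; split=> // x [].
  rewrite /F; have := @pickle_invK Z i; have := @pickle_invK Z j.
  case: (pickle_inv i) => [z|//]; case: (pickle_inv j) => [z'|//] /= z'j zi.
  rewrite /G; case: ifP => // _ /= cz; case: ifP => // _ /= cz'.
  by move: ij; rewrite -zi -z'j -cz -cz' eqxx.
rewrite FE measure_bigcup // -nneseriesZl //.
apply: (@le_trans _ _ (\sum_(0 <= i <oo | i \in [set: nat]) m (F i `&` S))%E).
  apply: lee_nneseries => [i _ _|i _].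
    by rewrite mule_ge0.
  rewrite /F; case: (pickle_inv i) => [z|] /=; last by rewrite measure0 mule0.
  rewrite /G; case: ifPn => [/set_mem|_]; first exact: H.
  by rewrite measure0 mule0.
rewrite -(@measure_bigcup _ _ _ m setT (fun i => F i `&` S)) //.
- rewrite -setI_bigcupl; apply: le_measure; rewrite ?inE //.
  by apply: measurableI => //; exact: bigcupT_measurable.
- by move=> i _; exact: measurableI.
- exact: trivIset_setIr.
Qed.

End MeasureUnions.

(** Read [d], [g] as the masses of an event and a subevent, and [x], [s] as the masses of their
    parts inside a test set. Over the common denominator [g * d], the difference has numerator
    [(x - s) * g - s * (d - g)], where both products lie between 0 and [g * (d - g)]. *)
Lemma conditional_ratio_dist (R : realFieldType) (x s g d : R) :
  0 <= s <= g -> s <= x -> x - s <= d - g -> 0 < d -> g <= d ->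
  `|x / d - s / g| <= (d - g) / d.
Proof.
move=> /andP[s0 sg] sx xs d0 gd.
(* For [g = 0] the second quotient is 0 by the convention on division, matching the zero set
   function used for an empty truncation. *)
have [g0|g0] := eqVneq g 0.
  rewrite g0 invr0 mulr0 !subr0 in sg xs *.
  rewrite ger0_norm; last by rewrite divr_ge0 ?(le_trans s0 sx) ?ltW.
  by rewrite ler_pM2r ?invr_gt0 //; lra.
have {}g0 : 0 < g by rewrite lt0r g0 (le_trans s0 sg).
have -> : x / d - s / g = (((x - s) * g - s * (d - g)) / g) / d.
  by field; rewrite !gt_eqF.
rewrite normrM [`|d^-1|]gtr0_norm ?invr_gt0 // ler_pM2r ?invr_gt0 //.
rewrite normrM [`|g^-1|]gtr0_norm ?invr_gt0 // ler_pdivrMr //.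
by rewrite ler_norml; apply/andP; split; nra.
Qed.

(** * Truncated components as probabilities on code space *)

Section Truncation.
Context {R : realType} {I : finType}.
Variables (K : I -> nat) (lam : I -> R * R) (t : I -> nat -> R * R)
          (p : I -> nat -> R) (Rad : R)
          (eta : (nat -> I) -> set (R * R) -> \bar R).
Hypothesis model : planar_model K lam t p Rad.
Hypothesis etaP : forall om, is_eta K lam t p om (eta om).
Variables (om : nat -> I) (m : {measure set codes -> \bar R}).
Hypothesis mlaw : code_law K p om m.
Hypothesis etaE : forall A, measurable A -> eta om A = m (Yseries lam t om @^-1` A).

Lemma measurable_fu (w : seq nat) : measurable_fun setT (fu lam t om w).
Proof.
have E z : fu lam t om w z = fprefix lam t om (nth 0%N w) (size w) z.
  by apply: fword_eq => j jw; rewrite nth_mkseq.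
rewrite [X in measurable_fun _ X](_ : _ = (fun z : R * R =>
  ((lamprod lam om (size w)).1 * z.1 + (- (lamprod lam om (size w)).2) * z.2 +
     (fprefix lam t om (nth 0%N w) (size w) (0, 0)).1,
   (lamprod lam om (size w)).2 * z.1 + (lamprod lam om (size w)).1 * z.2 +
     (fprefix lam t om (nth 0%N w) (size w) (0, 0)).2))).
  by apply: measurable_fun_pair; exact: measurable_affine.
apply/funext => z; rewrite E fprefix_affine /Defs.cadd /cmul.
by congr pair => /=; ring.
Qed.

Lemma word_cylinderE n (w : seq nat) : size w = n ->
  [set b : codes | mkseq b n = w] = cylinder n (nth 0%N w).
Proof.
move=> wn; apply/seteqP; split=> b /=.
  by move=> <- j jn; rewrite nth_mkseq.
move=> bw; apply: (@eq_from_nth _ 0%N); rewrite size_mkseq // => j jn.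
by rewrite nth_mkseq // bw.
Qed.

Lemma code_law_word n (w : seq nat) (B : set (R * R)) : measurable B ->
  w \in words K om n ->
  m (cylinder n (nth 0%N w) `&` shift_code n @^-1` (Yseries lam t (shiftn n om) @^-1` B)) =
  ((pu p om w)%:E * eta (shiftn n om) B)%E.
Proof.
move=> mB wW; have [m' m'law eta'E] := is_eta_code_law (etaP (shiftn n om)).
rewrite (code_law_shift mlaw _ m'law); last exact: measurable_Yseries_preimage.
by rewrite -(pu_words _ wW) eta'E.
Qed.

Lemma eta_fin n (B : set (R * R)) : measurable B -> eta (shiftn n om) B \is a fin_num.
Proof.
move=> mB; have [m' m'law eta'E] := is_eta_code_law (etaP (shiftn n om)).
by rewrite eta'E //; apply: (code_law_fin m'law); exact: measurable_Yseries_preimage.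
Qed.

(** Split the event according to the prefix of length [n]. On an admissible code with prefix [w] the
    coded point is [fu w] of the point coded by the tail, and independence gives each piece the
    corresponding summand as its mass. *)
Lemma trunc_sumE n (Q : pred (seq nat)) (B : set (R * R)) : measurable B ->
  (\sum_(w <- words K om n | Q w)
     pu p om w * fine (eta (shiftn n om) (fu lam t om w @^-1` B)))%:E =
  m ([set b | Q (mkseq b n)] `&` Yseries lam t om @^-1` B).
Proof.
move=> mB; have mad := measurable_admissible K om.
have mYB := measurable_Yseries_preimage lam t om mB.
have mQ := @measurable_prefix_set n Q.
rewrite -(code_law_admissible mlaw); last exact: measurableI.
rewrite [X in _ = m X](_ : _ = (Yseries lam t om @^-1` B `&` admissible K om) `&`
    [set b | mkseq b n \in [seq w <- words K om n | Q w]]); last first.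
  apply/seteqP; split=> b /=.
    by move=> [[Qb Bb] ab]; split=> //; rewrite mem_filter Qb mkseq_words.
  by move=> [[Bb ab]]; rewrite mem_filter => /andP[].
rewrite sum_prefix; [|exact: measurableI|by rewrite filter_uniq // words_uniq].
rewrite big_filter -sumEFin big_seq_cond [RHS]big_seq_cond.
apply: eq_bigr => w /andP[wW _].
have mfB : measurable (fu lam t om w @^-1` B).
  by rewrite -[X in measurable X]setTI; apply: measurable_fu.
rewrite EFinM fineK; last exact: eta_fin.
rewrite -code_law_word // -(code_law_admissible mlaw); last first.
  apply: measurableI; first exact: measurable_cylinder.
  rewrite -[X in measurable X]setTI; apply: measurable_shift_code => //.
  exact: measurable_Yseries_preimage.
have wn : size w = n by move: wW; rewrite mem_words => /andP[/eqP].
congr (m _); rewrite -word_cylinderE //.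
have fE b : mkseq b n = w -> admissible K om b -> Yseries lam t om b =
    fu lam t om w (Yseries lam t (shiftn n om) (shift_code n b)).
  by move=> bw ab; rewrite (Yseries_shift model n ab) /fprefix bw /fu wn.
apply/seteqP; split=> b /=.
  by move=> [[bw Bb] ab]; rewrite (fE b).
by move=> [[Bb ab] bw]; rewrite -(fE b).
Qed.

End Truncation.

(** * The choice of depth, and dyadic cells *)

Lemma powR_geometric_small (R : realType) (q M C rho e : R) :
  0 < q < 1 -> 0 < M -> 0 < C -> 0 < rho -> 0 < e ->
  exists N : nat, C * (q ^+ N * M) `^ rho < e.
Proof.
move=> /andP[q0 q1] M0 C0 rho0 e0.
have eC0 : 0 < e / C by rewrite divr_gt0.
(* The threshold [(e / C) ^ (1 / rho)] solves [C * y ^ rho = e], so it suffices to bring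
   [q ^+ N * M] below it. *)
have y0 : 0 < (e / C) `^ rho^-1 by rewrite powR_gt0.
have yM : 0 < (e / C) `^ rho^-1 / M by rewrite divr_gt0.
have q1' : `|q| < 1 by rewrite gtr0_norm.
have [N _ HN] := cvgr_dist_lt _ _ (cvg_expr q1') _ yM.
exists N; have := HN N (leqnn N); rewrite /= sub0r normrN.
rewrite gtr0_norm ?exprn_gt0 // ltr_pdivlMr // => H.
rewrite -ltr_pdivlMl // [ltRHS]mulrC.
rewrite [ltRHS](_ : _ = ((e / C) `^ rho^-1) `^ rho); last first.
  by rewrite -powRrM mulVf ?gt_eqF // powRr1 // ltW.
apply: gt0_ltr_powR => //; rewrite nnegrE ?ltW //.
by rewrite mulr_gt0 ?exprn_gt0.
Qed.

Section DyadicCells.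
Context {R : realType}.

(** Integer labels index the dyadic squares by a countable type, as the summation over cells
    requires. *)
Definition cell (k : nat) (x : R * R) : int * int :=
  (Num.floor (x.1 * 2 ^+ k), Num.floor (x.2 * 2 ^+ k)).

Lemma dyadicE k x : dyadic k x = cell k @^-1` [set cell k x].
Proof. by apply/seteqP; split=> y; case=> e1 e2; rewrite /dyadic /cell /= ?e1 ?e2. Qed.

Lemma measurable_cell k z : measurable (cell k @^-1` [set z]).
Proof.
have mf (f : R * R -> R) (j : int) : measurable_fun setT f ->
    measurable [set y | Num.floor (f y * 2 ^+ k) = j].
  move=> mf; rewrite [X in measurable X](_ : _ =
      f @^-1` `[j%:~R / 2 ^+ k, (j + 1)%:~R / 2 ^+ k[%classic).
    by rewrite -[X in measurable X]setTI; apply: mf.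
  apply/seteqP; split=> y /=; rewrite in_itv /= ler_pdivrMr ?ltr_pdivlMr ?exprn_gt0 //.
    by move=> <-; exact: floor_itv.
  by move=> H; apply: floor_def.
rewrite [X in measurable X](_ : _ = [set y | Num.floor (y.1 * 2 ^+ k) = z.1] `&`
    [set y | Num.floor (y.2 * 2 ^+ k) = z.2]).
  by apply: measurableI; apply: mf; [exact: measurable_fst|exact: measurable_snd].
by case: z => z1 z2; apply/seteqP; split=> y; case=> e1 e2; rewrite /cell /= ?e1 ?e2.
Qed.

End DyadicCells.

(** * Total variation between raw and truncated components *)

Section TruncationError.
Context {R : realType} {I : finType}.
Variables (K : I -> nat) (lam : I -> R * R) (t : I -> nat -> R * R)
          (p : I -> nat -> R) (Rad : R)
          (eta : (nat -> I) -> set (R * R) -> \bar R).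
Hypothesis model : planar_model K lam t p Rad.
Hypothesis etaP : forall om, is_eta K lam t p om (eta om).
Variables (om : nat -> I) (m : {measure set codes -> \bar R}).
Hypothesis mlaw : code_law K p om m.
Hypothesis etaE : forall A, measurable A -> eta om A = m (Yseries lam t om @^-1` A).

Definition contained_word (D : set (R * R)) (w : seq nat) : bool :=
  `[< fu lam t om w @` eball (0, 0) Rad `<=` D >].

Lemma eta_setT n : eta (shiftn n om) setT = 1%E.
Proof.
have [m' m'law eta'E] := is_eta_code_law (etaP (shiftn n om)).
by rewrite eta'E // preimage_setT (code_lawT m'law).
Qed.

Lemma sum_pu n (Q : pred (seq nat)) :
  (\sum_(w <- words K om n | Q w) pu p om w)%:E = m [set b | Q (mkseq b n)].
Proof.
have := trunc_sumE model etaP mlaw n Q (@measurableT _ (R * R)%type).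
rewrite preimage_setT setIT => <-; congr EFin; apply: eq_bigr => w _.
by rewrite preimage_setT eta_setT mulr1.
Qed.

Lemma fprefix_fu n b : fprefix lam t om b n = fu lam t om (mkseq b n).
Proof. by rewrite /fprefix /fu size_mkseq. Qed.

Lemma contained_word_sub n D b : admissible K om b ->
  contained_word D (mkseq b n) -> D (Yseries lam t om b).
Proof.
move=> ab /asboolP; apply; rewrite (Yseries_shift model n ab) fprefix_fu.
by exists (Yseries lam t (shiftn n om) (shift_code n b)) => //;
  exact: Yseries_eball model _ _ (admissible_shift n ab).
Qed.

Lemma fine_measure_split (A B : set codes) : measurable A -> measurable B ->
  fine (m A) = fine (m (A `\` B)) + fine (m (A `&` B)).
Proof.
move=> mA mB; have mAB := measurableI _ _ mA mB; have mADB := measurableD mA mB.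
rewrite -fineD ?(code_law_fin mlaw) //; congr fine.
exact: measureDI.
Qed.

Lemma le_fine_measure (A B : set codes) : measurable A -> measurable B ->
  A `<=` B -> fine (m A) <= fine (m B).
Proof.
move=> mA mB AB; apply: fine_le; rewrite ?(code_law_fin mlaw) //.
by apply: le_measure; rewrite ?inE.
Qed.

(** The two components are the laws conditioned on [E] and on its subevent [G'], so they differ by
    at most [(d - g) / d]. A distance of at least [eps] therefore makes the mass [d - g] of the
    missing codes at least [eps * d]. *)
Lemma large_dTV_bound n (D : set (R * R)) (eps : R) : measurable D -> 0 < eps ->
  eps <= dTV (rawcomp (eta om) D) (trunccomp K lam t p eta Rad om n D) ->
  (eps%:E * m (Yseries lam t om @^-1` D) <=
   m (Yseries lam t om @^-1` D `&`
      [set b | admissible K om b /\ ~~ contained_word D (mkseq b n)]))%E.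
Proof.
move=> mD eps0 Heps.
pose G : set codes := [set b | contained_word D (mkseq b n)].
have mG : measurable G := @measurable_prefix_set n (contained_word D).
have mad := measurable_admissible K om.
have mY A (mA : measurable A) := measurable_Yseries_preimage lam t om mA.
pose E : set codes := Yseries lam t om @^-1` D.
have mE : measurable E := mY _ mD.
pose G' := G `&` admissible K om.
have mG' : measurable G' by exact: measurableI.
have G'E : G' `<=` E by move=> b [Gb ab]; exact: contained_word_sub ab Gb.
set U := E `&` _.
have UE : U = (E `\` G') `&` admissible K om.
  apply/seteqP; split=> b.
    by move=> [Eb [ab /negP Gb]]; split=> //; split=> // -[].
  by move=> [[Eb Gb] ab]; split=> //; split=> //; apply/negP => Gb'; apply: Gb.
have mEG' : measurable (E `\` G') by exact: measurableD.
have -> : m U = m (E `\` G') by rewrite UE (code_law_admissible mlaw).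
(* On a square of mass zero the left-hand side vanishes; otherwise division by [d] is legitimate. *)
have [/eqP mE0|mE0] := boolP (m E == 0%E).
  by rewrite mE0 mule0.
pose d := fine (m E); pose g := fine (m G').
have d_gt0 : 0 < d by apply: fine_gt0; rewrite lt0e mE0 measure_ge0 /= -ge0_fin_numE ?(code_law_fin mlaw).
have dg : d = fine (m (E `\` G')) + g.
  by rewrite /d (fine_measure_split mE mG') /g; congr (_ + fine (m _)); apply: setIidr.
suff H : dTV (rawcomp (eta om) D) (trunccomp K lam t p eta Rad om n D) <= (d - g) / d.
  have := le_trans Heps H; rewrite ler_pdivlMr // => {}H.
  rewrite -[m E]fineK ?(code_law_fin mlaw) // -[leRHS]fineK ?(code_law_fin mlaw) //.
  by rewrite -EFinM lee_fin (le_trans H) // dg addrK.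
apply: ge_sup; first by eexists; exists set0; [exact: measurable0|reflexivity].
move=> _ [A mA <-]; rewrite /rawcomp /trunccomp.
have mAD : measurable (A `&` D) by exact: measurableI.
have mYA := mY _ mA; have mYAD := mY _ mAD.
rewrite !etaE // -[fine (m (Yseries lam t om @^-1` D))]/d.
have -> : (\sum_(u <- words K om n | `[< fu lam t om u @` eball (0, 0) Rad `<=` D >])
    pu p om u * fine (eta (shiftn n om) (fu lam t om u @^-1` A))) =
    fine (m (G' `&` Yseries lam t om @^-1` A)).
  rewrite -[LHS]/(fine (_)%:E) (trunc_sumE model etaP mlaw n (contained_word D) mA).
  rewrite -(code_law_admissible mlaw); last exact: measurableI.
  by rewrite setIAC.
have -> : (\sum_(u <- words K om n | `[< fu lam t om u @` eball (0, 0) Rad `<=` D >])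
    pu p om u) = g.
  rewrite -[LHS]/(fine (_)%:E) (sum_pu n (contained_word D)).
  by rewrite -(code_law_admissible mlaw).
have mGA : measurable (G' `&` Yseries lam t om @^-1` A) by exact: measurableI.
have gd : g <= d by apply: le_fine_measure.
have s_le : G' `&` Yseries lam t om @^-1` A `<=` Yseries lam t om @^-1` (A `&` D).
  by move=> b [Gb Ab]; split=> //; exact: G'E.
apply: conditional_ratio_dist => //.
- by rewrite fine_ge0 //= le_fine_measure.
- exact: le_fine_measure.
- rewrite dg addrK (fine_measure_split mYAD mG').
  have -> : Yseries lam t om @^-1` (A `&` D) `&` G' = G' `&` Yseries lam t om @^-1` A.
    by apply/seteqP; split=> b; [move=> [[Ab Db] Gb]|move=> [Gb Ab]; split=> //; apply: s_le].
  rewrite addrK le_fine_measure //; first exact: measurableD.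
  by move=> b [[Ab Db] Gb].
Qed.

End TruncationError.

(** * Crossing a dyadic grid line, and the Frostman bound *)

Section GridStrips.
Context {R : realType} {I : finType}.
Variables (K : I -> nat) (lam : I -> R * R) (t : I -> nat -> R * R)
          (p : I -> nat -> R) (Rad : R).
Hypothesis model : planar_model K lam t p Rad.
Variables (om : nat -> I) (k kp : nat).
Hypothesis kprime : is_kprime lam Rad om k kp.

Let ratio := \prod_(j < kp) rr lam (om j).

Lemma prod_rr_gt0 (om' : nat -> I) n : 0 < \prod_(j < n) rr lam (om' j).
Proof.
have [_ [rr01 _]] := model.
by apply: prodr_gt0 => j _; case/andP: (rr01 (om' j)).
Qed.

Lemma kprime_scale_le : 2 * Rad * ratio * 2 ^+ k <= 1.
Proof.
have [H _] := kprime.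
by rewrite -ler_pdivlMr ?exprn_gt0 // mul1r.
Qed.

(** Minimality of [kp] gives [1 < 2 ^+ k * 2 * Rad * x] for the product [x] without the last ratio,
    and that ratio exceeds [1 / (4 * Rad)]; together these give the bound [8 * Rad ^+ 2]. The added
    1 covers [kp = 0], where the product is empty. *)
Lemma kprime_scale_ge : (2 ^+ k * ratio)^-1 <= 8 * Rad ^+ 2 + 1.
Proof.
have [_ [rr01 [_ [Rad_gt0 [_ Rad_rr]]]]] := model.
have [_ H] := kprime.
have k0 : 0 < 2 ^+ k :> R by rewrite exprn_gt0.
have r0 : 0 < ratio := prod_rr_gt0 om kp.
have M0 : 0 < 8 * Rad ^+ 2 + 1 by have := sqr_ge0 Rad; lra.
rewrite invf_ple ?posrE ?mulr_gt0 //.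
rewrite /ratio in r0 *; case: kp H r0 => [_ _|kq H r0].
  rewrite big_ord0 mulr1; apply: (@le_trans _ _ 1); last by rewrite exprn_ege1 // ler1n.
  by rewrite invf_le1 //; have := sqr_ge0 Rad; lra.
have := H kq (ltnSn _); rewrite big_ord_recr /=.
set x := \prod_(i < kq) _; have x0 : 0 < x := prod_rr_gt0 om kq.
have := Rad_rr (om kq); set r := rr lam (om kq) => Rr.
rewrite invf_plt ?posrE ?mulr_gt0 // => /ltW Hk.
have A : 1 <= 2 ^+ k * (2 * Rad * x).
  by rewrite -ler_pdivrMr ?mulr_gt0 // mul1r.
rewrite -[leLHS]mul1r ler_pdivrMr //.
set y := 2 ^+ k * x.
have yA : 1 <= 2 * Rad * y by rewrite /y; move: A; rewrite mulrCA.
rewrite mulrA -/y.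
have yr : 1 / 2 * y <= 2 * Rad * r * y.
  by rewrite ler_pM2r ?mulr_gt0 // ltW.
have : (1 / 2 * y) * (4 * Rad) <= 2 * Rad * r * y * (4 * Rad).
  by rewrite ler_pM2r // mulr_gt0.
have : 0 < y * r by rewrite !mulr_gt0 // /r; case/andP: (rr01 (om kq)).
by move=> yr0 yR; nra.
Qed.

(** The preimage, under the affine map of the prefix [w], of the points whose coordinate, rescaled
    by [2 ^+ k], is within [r] of the integer nearest to that of the disc centre. The two sets treat
    the two grid directions; [l] is the complex ratio of the map and [c] its value at 0. *)
Definition grid_strip (r : R) (w : seq nat) : set (R * R) :=
  let l := lamprod lam om kp in let c := fword lam t om w kp (0, 0) in
  [set y | `|2 ^+ k * l.1 * y.1 + - (2 ^+ k * l.2) * y.2 +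
             (c.1 * 2 ^+ k - (Num.floor (c.1 * 2 ^+ k + 1 / 2))%:~R)| < r] `|`
  [set y | `|2 ^+ k * l.2 * y.1 + 2 ^+ k * l.1 * y.2 +
             (c.2 * 2 ^+ k - (Num.floor (c.2 * 2 ^+ k + 1 / 2))%:~R)| < r].

Lemma measurable_grid_strip r w : measurable (grid_strip r w).
Proof. by apply: measurableU; exact: measurable_strip. Qed.

(* Since [B_v] has diameter at most [2^-k], it meets at most one grid line in each
   direction, so the line crossed by a subdisc is determined by the prefix [v]. *)
Lemma crossing_grid_strip q N b : (forall i, rr lam i <= q) -> 0 < q ->
  admissible K om b ->
  ~~ contained_word lam t Rad om (dyadic k (Yseries lam t om b)) (mkseq b (kp + N)) ->
  grid_strip (q ^+ N) (mkseq b kp) (Yseries lam t (shiftn kp om) (shift_code kp b)).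
Proof.
move=> rrq q0 ab /asboolP H.
have [_ [_ [_ [Rad_gt0 _]]]] := model.
(* A point [y] of the small disc outside the square of [Y]; [Y] lies in the same small disc. *)
have [y [[z zB yE] Dy]] : exists y, (fu lam t om (mkseq b (kp + N)) @` eball (0, 0) Rad) y /\
    ~ dyadic k (Yseries lam t om b) y.
  by apply: contrapT => nH; apply: H => y yB; apply: contrapT => Dy; apply: nH; exists y.
set Y := Yseries lam t om b in Dy.
set Z := Yseries _ _ _ _.
have k0 : 0 < 2 ^+ k :> R by rewrite exprn_gt0.
have YE : Y = fprefix lam t om b kp Z := Yseries_shift model kp ab.
have ZB : eball (0, 0) Rad Z := Yseries_eball model (admissible_shift kp ab).
pose Z' := Yseries lam t (shiftn (kp + N) om) (shift_code (kp + N) b).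
have YE' : Y = fprefix lam t om b (kp + N) Z' := Yseries_shift model (kp + N) ab.
have ZB' : eball (0, 0) Rad Z' := Yseries_eball model (admissible_shift (kp + N) ab).
rewrite -fprefix_fu in yE.
pose c := fprefix lam t om b kp (0, 0).
have prodq : \prod_(j < kp + N) rr lam (om j) <= ratio * q ^+ N.
  rewrite big_split_ord /= -/ratio ler_pM2l ?prod_rr_gt0 //.
  rewrite -[N in X in _ <= X]card_ord -prodr_const.
  by apply: ler_prod => j _; rewrite rrq cnorm_ge0.
(* Stated for an abstract coordinate [pr], to be used for both directions. Both points are within
   [1 / 2] of the rescaled centre of the large disc, and within [q ^+ N] of each other after
   rescaling. *)
have key (pr : R * R -> R) :
    (forall om a n z, eball (0, 0) Rad z ->
      `|pr (fprefix lam t om a n z) - pr (fprefix lam t om a n (0, 0))| <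
        Rad * \prod_(j < n) rr lam (om j)) ->
    Num.floor (pr Y * 2 ^+ k) <> Num.floor (pr y * 2 ^+ k) ->
    `|pr Y * 2 ^+ k - (Num.floor (pr c * 2 ^+ k + 1 / 2))%:~R| < q ^+ N.
  move=> prd.
  apply: (@floor_neq_dist _ _ _ _ _ (Rad * ratio * 2 ^+ k)).
  - by have := kprime_scale_le; lra.
  - rewrite -mulrBl normrM (gtr0_norm k0) ltr_pM2r // YE; exact: prd.
  - rewrite -mulrBl normrM (gtr0_norm k0) ltr_pM2r // -yE fprefixD; apply: prd.
    by apply: (fprefix_eball model) => //; exact: admissible_shift.
  - rewrite -mulrBl normrM (gtr0_norm k0) -ltr_pdivlMr //.
    have d1 := prd om b (kp + N)%N Z' ZB'; have d2 := prd om b (kp + N)%N z zB.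
    rewrite -YE' in d1; rewrite yE in d2.
    have rk : 2 * Rad * ratio <= 1 / 2 ^+ k by rewrite ler_pdivlMr // kprime_scale_le.
    have qN : 0 < q ^+ N by rewrite exprn_gt0.
    have h1 : Rad * \prod_(j < kp + N) rr lam (om j) <= Rad * (ratio * q ^+ N).
      by rewrite ler_pM2l.
    have h2 : 2 * Rad * ratio * q ^+ N <= 1 / 2 ^+ k * q ^+ N by rewrite ler_pM2r.
    have -> : q ^+ N / 2 ^+ k = 1 / 2 ^+ k * q ^+ N by rewrite mul1r mulrC.
    move: d1 d2; rewrite !ltr_norml => /andP[? ?] /andP[? ?].
    by apply/andP; split; lra.
have cE : fword lam t om (mkseq b kp) kp (0, 0) = c by [].
rewrite /grid_strip cE; move: YE; rewrite fprefix_affine -/c => YE.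
have [e1|e1] := eqVneq (Num.floor (Y.1 * 2 ^+ k)) (Num.floor (y.1 * 2 ^+ k)).
  right; have /key : Num.floor (Y.2 * 2 ^+ k) <> Num.floor (y.2 * 2 ^+ k).
    by move=> e2; apply: Dy; split.
  rewrite {1}YE /= => /(_ (fprefix_snd_dist model)).
  congr (`|_| < _); ring.
left; have /key : Num.floor (Y.1 * 2 ^+ k) <> Num.floor (y.1 * 2 ^+ k) by exact/eqP.
rewrite {1}YE /= => /(_ (fprefix_fst_dist model)).
congr (`|_| < _); ring.
Qed.

Lemma frostman_strip C rho (nu : set (R * R) -> \bar R) (a b e r : R) :
  frostman_tubes C rho nu -> 0 < cnorm (a, b) -> 0 < r ->
  (nu [set y | (`|a * y.1 + b * y.2 + e| < r)%R] <= (C * (r / cnorm (a, b)) `^ rho)%:E)%E.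
Proof.
move=> fr ab0 r0.
have ab_neq0 : (a, b) != (0, 0).
  by apply: contraTneq ab0 => -[-> ->]; rewrite /cnorm /= expr0n /= addr0 sqrtr0 ltxx.
rewrite -tubeE //; apply: fr; last by rewrite divr_gt0.
by apply: contra ab_neq0 => /eqP[/eqP]; rewrite oppr_eq0 => /eqP -> ->.
Qed.

(** Both linear forms have a normal of norm [2 ^+ k * ratio], so each strip is a tube of radius
    [r / (2 ^+ k * ratio)], at most [r * (8 * Rad ^+ 2 + 1)]. The factor 2 counts the directions. *)
Lemma grid_strip_le C rho (nu : set (R * R) -> \bar R) r w :
  (forall A B, measurable A -> measurable B -> (nu (A `|` B) <= nu A + nu B)%E) ->
  frostman_tubes C rho nu -> 0 < C -> 0 < rho -> 0 < r ->
  (nu (grid_strip r w) <= (2 * C * (r * (8 * Rad ^+ 2 + 1)) `^ rho)%:E)%E.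
Proof.
move=> nuU fr C0 rho0 r0.
have k0 : 0 < 2 ^+ k :> R by rewrite exprn_gt0.
have r1 : 0 < ratio := prod_rr_gt0 om kp.
have sc0 : 0 < 2 ^+ k * ratio by rewrite mulr_gt0.
have side (a b e : R) : cnorm (a, b) = 2 ^+ k * ratio ->
    (nu [set y | (`|a * y.1 + b * y.2 + e| < r)%R] <=
      (C * (r * (8 * Rad ^+ 2 + 1)) `^ rho)%:E)%E.
  move=> abE; apply: le_trans (frostman_strip _ fr _ r0) _; rewrite abE //.
  rewrite lee_fin ler_pM2l //; apply: ge0_ler_powR; rewrite ?nnegrE ?(ltW rho0) //.
  - by rewrite divr_ge0 ?ltW.
  - by rewrite mulr_ge0 ?(ltW r0) // addr_ge0 // mulr_ge0 // sqr_ge0.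
  - by rewrite ler_pM2l // kprime_scale_ge.
have sE (x y : R) : cnorm (x, y) = cnorm (lamprod lam om kp) ->
    cnorm (2 ^+ k * x, 2 ^+ k * y) = 2 ^+ k * ratio.
  move=> xy; have -> : (2 ^+ k * x, 2 ^+ k * y) = cmul (2 ^+ k, 0) (x, y).
    by rewrite /cmul /=; congr pair; ring.
  rewrite cnormM xy cnorm_lamprod; congr (_ * _).
  by rewrite /cnorm /= expr0n /= addr0 sqrtr_sqr gtr0_norm.
apply: le_trans (nuU _ _ _ _) _; [exact: measurable_strip..|].
have -> (x : R) : 2 * C * x = C * x + C * x by ring.
rewrite EFinD leeD //; apply: side.
  by rewrite -mulrN sE // /cnorm /= sqrrN.
by rewrite sE // /cnorm /= addrC.
Qed.

End GridStrips.

(** * Mass of the crossing codes and the final estimate *)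

Section Main.
Context {R : realType} {I : finType}.
Variables (K : I -> nat) (lam : I -> R * R) (t : I -> nat -> R * R)
          (p : I -> nat -> R) (Rad : R)
          (eta : (nat -> I) -> set (R * R) -> \bar R).
Hypothesis model : planar_model K lam t p Rad.
Hypothesis etaP : forall om, is_eta K lam t p om (eta om).

Lemma eta_setU_le om A B : measurable A -> measurable B ->
  (eta om (A `|` B) <= eta om A + eta om B)%E.
Proof.
move=> mA mB; have [m mlaw etaE] := is_eta_code_law (etaP om).
rewrite !etaE //; last exact: measurableU.
by rewrite preimage_setU; apply: measureU2; exact: measurable_Yseries_preimage.
Qed.

(** The strip depends on the prefix alone and is tested on the point coded by the tail, so
    independence applies piece by piece. *)
Definition crossing_codes om k kp (r : R) : set codes :=
  \big[setU/set0]_(w <- words K om kp) (cylinder kp (nth 0%N w) `&`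
    shift_code kp @^-1` (Yseries lam t (shiftn kp om) @^-1` grid_strip lam t om k kp r w)).

Lemma measurable_crossing_piece om k kp (r : R) w :
  measurable (cylinder kp (nth 0%N w) `&` shift_code kp @^-1`
    (Yseries lam t (shiftn kp om) @^-1` grid_strip lam t om k kp r w) : set codes).
Proof.
apply: measurableI; first exact: measurable_cylinder.
rewrite -[X in measurable X]setTI; apply: measurable_shift_code => //.
by apply: measurable_Yseries_preimage; exact: measurable_grid_strip.
Qed.

(** Given the prefix, the tail falls in its strip with probability at most a bound [B] common to all
    prefixes; the prefix weights sum to 1. *)
Lemma crossing_codes_le om m k kp C rho (r : R) : code_law K p om m ->
  is_kprime lam Rad om k kp -> frostman_tubes C rho (eta (shiftn kp om)) ->
  0 < C -> 0 < rho -> 0 < r ->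
  (m (crossing_codes om k kp r) <= (2 * C * (r * (8 * Rad ^+ 2 + 1)) `^ rho)%:E)%E.
Proof.
move=> mlaw kprime fr C0 rho0 r0; set B := (X in (_ <= X%:E)%E).
apply: le_trans (measure_bigsetU_le _ _ _) _.
  by move=> w; exact: measurable_crossing_piece.
have B0 : 0 <= B by rewrite !mulr_ge0 ?powR_ge0 // ltW.
have pu1 : \sum_(w <- words K om kp) pu p om w = 1.
  apply/EFin_inj; rewrite (sum_pu model etaP mlaw kp predT).
  by rewrite -(code_lawT mlaw); congr (m _); apply/seteqP; split.
have pu0 w : w \in words K om kp -> (0 <= (pu p om w)%:E)%E.
  by move=> wW; rewrite (pu_words _ wW) -mlaw.
rewrite -[leRHS]mul1e -pu1 -sumEFin big_seq [in leRHS]big_seq ge0_sume_distrl //.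
apply: lee_sum => w wW.
rewrite (code_law_word etaP mlaw) //; last exact: measurable_grid_strip.
rewrite lee_wpmul2l ?pu0 //.
by apply: (grid_strip_le model kprime) fr _ _ _ => // A A' *; exact: eta_setU_le.
Qed.

Lemma truncated_component_close (eps C rho : R) : 0 < eps -> 0 < C -> 0 < rho ->
  exists Neps : nat, forall (om : nat -> I) (k kp : nat),
    is_kprime lam Rad om k kp -> frostman_tubes C rho (eta (shiftn kp om)) ->
    ((1 - eps)%:E < eta om [set x |
      (dTV (rawcomp (eta om) (dyadic k x))
        (trunccomp K lam t p eta Rad om (kp + Neps) (dyadic k x)) < eps)%R])%E.
Proof.
move=> eps0 C0 rho0.
have [q q01 rrq] := contraction_ratio_uniform model.
have /andP[q0 _] := q01.
have M0 : 0 < 8 * Rad ^+ 2 + 1 by have := sqr_ge0 Rad; lra.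
have C2 : 0 < 2 * C by rewrite mulr_gt0.
(* The target is [eps * eps] because Markov's inequality costs one factor [eps]. The resulting [N]
   involves neither [om] nor [k]. *)
have [N HN] := powR_geometric_small q01 M0 C2 rho0 (mulr_gt0 eps0 eps0).
exists N => om k kp kprime fr.
have [m mlaw etaE] := is_eta_code_law (etaP om).
set good := [set x | _].
pose badcell : set (int * int) := [set z |
  eps <= dTV (rawcomp (eta om) (cell k @^-1` [set z]))
    (trunccomp K lam t p eta Rad om (kp + N) (cell k @^-1` [set z]))].
(* Being good depends only on the cell of the point, so the good set is a union of countably many
   cells and is measurable. *)
have goodE : good = cell k @^-1` (~` badcell).
  by apply/seteqP; split=> x; rewrite /good /badcell /= dyadicE ltNge => /negP.
have mgood : measurable good.
  by rewrite goodE; apply: measurable_countable_preimage; exact: measurable_cell.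
have mcell z : measurable ((cell k \o Yseries lam t om) @^-1` [set z] : set codes).
  by rewrite comp_preimage; apply: measurable_Yseries_preimage; exact: measurable_cell.
pose S := crossing_codes om k kp (q ^+ N).
have mS : measurable S.
  by apply: bigsetU_measurable => w _; exact: measurable_crossing_piece.
have mbad : measurable ((cell k \o Yseries lam t om) @^-1` badcell : set codes).
  exact: measurable_countable_preimage.
have Hbad : (eps%:E * m ((cell k \o Yseries lam t om) @^-1` badcell) <= m S)%E.
  apply: measure_bad_cells_le => //; first exact: ltW.
  move=> z bz; rewrite comp_preimage.
  apply: le_trans (large_dTV_bound model etaP mlaw etaE (measurable_cell k z) eps0 bz) _.
  apply: le_measure; rewrite ?inE.
  - apply: measurableI; first exact: mcell.
    apply: measurableI; first exact: measurable_admissible.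
    exact: (@measurable_prefix_set (kp + N) [set w | ~~ contained_word lam t Rad om _ w]).
  - by apply: measurableI => //; exact: mcell.
  (* An admissible code whose disc leaves its square has its tail point in the strip of its own
     prefix of length [kp]. *)
  - move=> b [Yz [ab Hb]]; split=> //.
    rewrite /S /crossing_codes -bigcup_seq.
    exists (mkseq b kp); first exact: mkseq_words.
    split; first by move=> j jn; rewrite nth_mkseq.
    apply: (crossing_grid_strip model kprime) => //.
    by rewrite dyadicE (_ : cell k _ = z).
have mbad_lt : (m ((cell k \o Yseries lam t om) @^-1` badcell) < eps%:E)%E.
  rewrite -(@lte_pmul2l _ eps%:E) //.
  apply: le_lt_trans Hbad _; apply: le_lt_trans.
    exact: (crossing_codes_le mlaw kprime fr C0 rho0 (exprn_gt0 N q0)).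
  by rewrite -EFinM lte_fin.
rewrite etaE // goodE.
have := fine_measure_split mlaw (@measurableT _ codes) mbad.
rewrite setTD setTI (code_lawT mlaw) /= => split1.
rewrite -[Yseries lam t om @^-1` _]/(~` ((cell k \o Yseries lam t om) @^-1` badcell)).
move: mbad_lt; rewrite -[m _]fineK ?(code_law_fin mlaw) // lte_fin => bad_lt.
rewrite -[m (~` _)]fineK; last by apply: (code_law_fin mlaw); exact: measurableC.
by rewrite lte_fin; lra.
Qed.

End Main.

Theorem lemma3p14 (R : realType) (I : finType) (K : I -> nat)
  (lam : I -> R * R) (t : I -> nat -> R * R) (p : I -> nat -> R) (Rad : R)
  (eta : (nat -> I) -> set (R * R) -> \bar R) :
  planar_model K lam t p Rad ->
  (forall om, is_eta K lam t p om (eta om)) ->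
  forall eps C rho : R, 0 < eps -> 0 < C -> 0 < rho ->
  exists Neps : nat,
    forall (om : nat -> I) (k kp : nat),
      is_kprime lam Rad om k kp ->
      frostman_tubes C rho (eta (shiftn kp om)) ->
      forall n : nat, n = (kp + Neps)%N ->
        ((1 - eps)%:E <
         eta om [set x | (dTV (rawcomp (eta om) (dyadic k x))
                             (trunccomp K lam t p eta Rad om n (dyadic k x)) < eps)%R])%E.
Proof.
move=> model etaP eps C rho eps0 C0 rho0.
have [N HN] := truncated_component_close model etaP eps0 C0 rho0.
by exists N => om k kp kprime fr _ ->; exact: HN.
Qed.
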